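(* Let $G$ be a finite non-abelian group, let $H$ be a subgroup of $G$ with $H \neq Z(H,G)$, and let $g \in K(H,G)$. If $g \neq 1$, then $\Gamma_{H,G}^g$ is not a complete graph.
   Context: For $x,y$ in a group, $[x,y] = x^{-1}y^{-1}xy$. For a subgroup $H$ of $G$: $Z(H,G) = \{x \in H : xy = yx \text{ for all } y \in G\}$ and $K(H,G) = \{[x,y] : x \in H,\ y \in G\}$. The relative $g$-noncommuting graph $\Gamma_{H,G}^g$ is the simple undirected graph with vertex set $G$ in which two distinct vertices $x,y$ are adjacent if and only if ($x \in H$ or $y \in H$) and $[x,y] \neq g$ and $[x,y] \neq g^{-1}$. *)

(* Defs.v *)
From mathcomp Require Import all_boot all_fingroup.

Set Implicit Arguments.
Unset Strict Implicit.
Unset Printing Implicit Defensive.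

Import GroupScope.

Record sgraph (T : finType) := SGraph {
  vertices : {set T};
  adj : rel T;
  adj_vertices : forall x y, adj x y -> (x \in vertices) && (y \in vertices);
  adj_sym : symmetric adj;
  adj_irrefl : irreflexive adj }.

Definition complete_graph (T : finType) (Gamma : sgraph T) : Prop :=
  {in vertices Gamma &, forall x y, x != y -> adj Gamma x y}.

Section RelativeNoncommutingGraph.

Variables (gT : finGroupType) (H G : {group gT}) (g : gT).

(* [~ x, y] is x^-1 * y^-1 * x * y, by commgEl and conjgE. *)
Definition rel_noncomm_adj : rel gT := fun x y =>
  [&& x \in G, y \in G, x != y, (x \in H) || (y \in H),
      [~ x, y] != g & [~ x, y] != g^-1].

Lemma rel_noncomm_adj_vertices x y :
  rel_noncomm_adj x y -> (x \in G) && (y \in G).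
Proof. by case/and3P=> -> ->. Qed.

Lemma rel_noncomm_adj_sym : symmetric rel_noncomm_adj.
Proof.
move=> x y; rewrite /rel_noncomm_adj -(invg_comm x y) (eq_sym y x) orbC.
rewrite (inj_eq invg_inj) -{3}[g]invgK (inj_eq invg_inj).
by do !bool_congr.
Qed.

Lemma rel_noncomm_adj_irrefl : irreflexive rel_noncomm_adj.
Proof. by move=> x; rewrite /rel_noncomm_adj eqxx !andbF. Qed.

Definition rel_noncomm_graph : sgraph gT :=
  SGraph rel_noncomm_adj_vertices rel_noncomm_adj_sym rel_noncomm_adj_irrefl.

End RelativeNoncommutingGraph.

(* Main.v *)
Require Import Defs.
From mathcomp Require Import all_boot all_fingroup.

Import GroupScope.

(* Z(H, G) is 'C_H(G) and K(H, G) is commg_set H G. *)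
Theorem theorem2p10 (gT : finGroupType) (G H : {group gT}) (g : gT)
  (nonabelG : ~~ abelian G) (sHG : H \subset G) (neHZ : H :<>: 'C_H(G))
  (gK : g \in commg_set H G) (g_neq1 : g <> 1) :
  ~ complete_graph (rel_noncomm_graph H G g).
Proof.
(* Writing g as a commutator of x in H and y in G exhibits a missing edge:
   x and y differ because g <> 1 while [~ x, x] = 1. *)
move=> complGamma; case/imset2P: gK => x y Hx Gy def_g.
have Gx : x \in G := subsetP sHG x Hx.
have neq_xy : x != y.
  by apply/eqP=> eq_xy; apply: g_neq1; rewrite def_g -eq_xy commgg.
have /and5P[_ _ _ _ /andP[]] := complGamma x y Gx Gy neq_xy.
by rewrite -def_g eqxx.
Qed.
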